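(* Let $G=(V,A)$ be a directed graph that is not Eulerian, i.e. there exists $v\in V$ with $\partial(\{v\})\neq 0$, and let $b:\mathcal{P}(V)\to\mathbb{Z}$ be submodular. Then $$\sigma^* = \max_{X,Y\subseteq V}\left\{\sigma(X,Y) : \partial(X)\ge 0,\ \partial(Y)<0,\ \varrho(X)+\delta(X)>0\right\},$$ where $$\sigma(X,Y):=\frac{b(X)\partial(Y)-b(Y)\partial(X)}{\delta(Y)\partial(X)-\delta(X)\partial(Y)},$$ or $\sigma^*=0$ if the value of this maximum is negative.
   Context: $G=(V,A)$ is a finite directed graph and $\mathcal{P}(V)$ is the power set of $V$. For $X\subseteq V$, $\varrho(X)$ and $\delta(X)$ denote the number of edges entering $X$ and leaving $X$, respectively, and $\partial(X):=\varrho(X)-\delta(X)$. For $x\in\mathbb{R}^A$, $\varrho_x(X)$ and $\delta_x(X)$ denote the sum of $x(e)$ over the edges $e$ entering, resp. leaving, $X$. The function $b$ is submodular if $b(X)+b(Y)\ge b(X\cup Y)+b(X\cap Y)$ for all $X,Y\subseteq V$. A submodular flow is a vector $x\in\mathbb{R}^A$ with $\varrho_x(X)-\delta_x(X)\le b(X)$ for every $X\subseteq V$. The spread of $x\in\mathbb{R}^A$ is $\sigma(x):=\max_{a\in A}x(a)-\min_{a\in A}x(a)$, and $\sigma^*$ is the minimum of $\sigma(x)$ over all submodular flows $x$. Standing assumptions: $G$ has no isolated vertex, and a submodular flow exists, i.e. $b(U)\ge 0$ for every $U\subseteq V$ with $\varrho(U)=0$ and $\delta(U)=0$. (Under $\partial(X)\ge0$,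 $\partial(Y)<0$, the condition $\varrho(X)+\delta(X)>0$ is equivalent to the denominator of $\sigma(X,Y)$ being nonzero.) *)

(* Defs.v *)
From HB Require Import structures.
From mathcomp Require Import all_boot all_order all_algebra.
From mathcomp Require Import classical_sets reals.

Set Implicit Arguments.
Unset Strict Implicit.
Unset Printing Implicit Defensive.

Import Order.TTheory GRing.Theory Num.Theory.
Local Open Scope ring_scope.

(* Parallel edges and loops are allowed; a loop neither enters nor leaves any
   vertex set. *)
Record digraph (V A : finType) := Digraph { src : A -> V; tgt : A -> V }.

Definition enters (V A : finType) (G : digraph V A) (X : {set V}) (a : A) : bool :=
  (src G a \notin X) && (tgt G a \in X).

Definition leaves (V A : finType) (G : digraph V A) (X : {set V}) (a : A) : bool :=
  (src G a \in X) && (tgt G a \notin X).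

Definition rho (V A : finType) (G : digraph V A) (X : {set V}) : nat :=
  #|[pred a | enters G X a]|.

Definition delta (V A : finType) (G : digraph V A) (X : {set V}) : nat :=
  #|[pred a | leaves G X a]|.

Definition partial (V A : finType) (G : digraph V A) (X : {set V}) : int :=
  (rho G X)%:Z - (delta G X)%:Z.

Definition rho_w (R : realType) (V A : finType) (G : digraph V A)
    (x : A -> R) (X : {set V}) : R := \sum_(a | enters G X a) x a.

Definition delta_w (R : realType) (V A : finType) (G : digraph V A)
    (x : A -> R) (X : {set V}) : R := \sum_(a | leaves G X a) x a.

Definition no_isolated_vertex (V A : finType) (G : digraph V A) : Prop :=
  forall v : V, exists a : A, src G a = v \/ tgt G a = v.

Definition not_eulerian (V A : finType) (G : digraph V A) : Prop :=
  exists v : V, partial G [set v]%SET <> 0.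

Definition submodular (V : finType) (b : {set V} -> int) : Prop :=
  forall X Y : {set V}, b (X :|: Y) + b (X :&: Y) <= b X + b Y.

Definition submodular_flow (R : realType) (V A : finType) (G : digraph V A)
    (b : {set V} -> int) (x : A -> R) : Prop :=
  forall X : {set V}, rho_w G x X - delta_w G x X <= (b X)%:~R.

(* The value at x a0 is only the initial value of the iterated max and min: the
   result does not depend on the edge a0 picked.  The branch 0 is the junk value
   for an edgeless graph. *)
Definition spread (R : realType) (A : finType) (x : A -> R) : R :=
  if [pick a : A] is Some a0 then
    \big[Num.max/x a0]_(a : A) x a - \big[Num.min/x a0]_(a : A) x a
  else 0.

Definition sigma (R : realType) (V A : finType) (G : digraph V A)
    (b : {set V} -> int) (X Y : {set V}) : R :=
  (b X * partial G Y - b Y * partial G X)%:~R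
  / ((delta G Y)%:Z * partial G X - (delta G X)%:Z * partial G Y)%:~R.

Definition admissible (V A : finType) (G : digraph V A) (X Y : {set V}) : Prop :=
  [/\ 0 <= partial G X, partial G Y < 0 & (0 < rho G X + delta G X)%N].

Definition is_minimum (R : realType) (S : set R) (m : R) : Prop :=
  S m /\ lbound S m.

Definition is_maximum (R : realType) (S : set R) (m : R) : Prop :=
  S m /\ ubound S m.

Definition flow_spreads (R : realType) (V A : finType) (G : digraph V A)
    (b : {set V} -> int) : set R :=
  [set s | exists2 x : A -> R, submodular_flow G b x & s = spread x]%classic.

Definition sigma_values (R : realType) (V A : finType) (G : digraph V A)
    (b : {set V} -> int) : set R :=
  [set s | exists X Y : {set V}, admissible G X Y /\ s = sigma R G b X Y]%classic.

(* Main.v *)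
Require Import Defs.
From HB Require Import structures.
From mathcomp Require Import all_boot all_order all_algebra.
From mathcomp Require Import classical_sets reals.
From mathcomp Require Import zify ring lra.

Set Implicit Arguments.
Unset Strict Implicit.
Unset Printing Implicit Defensive.

Import Order.TTheory GRing.Theory Num.Theory.
Local Open Scope ring_scope.

(** The spread is governed by boxes [l, l + s]^A with constant bounds: a
    flow of spread s lies in such a box, and a flow in such a box has spread at
    most s.  So the minimum spread is the least s >= 0 for which some box of
    width s contains a submodular flow.

    The feasibility theorem for submodular flows ([flow_in_box]) says that a
    box f <= x <= g contains a submodular flow as soon as
    rho_f(X) - delta_g(X) <= b(X) for every X, a condition that is clearly
    necessary.  It is proved by fixing the value of one edge a after another:
    the sets entered by a bound that value from above, those left by a bound
    it from below, and for X entered and Y left by a the two bounds are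
    compatible by uncrossing, because a neither enters nor leaves the union and
    the intersection of X and Y.

    For the constant box the condition reads l * partial X <= b X + s * delta X
    for all X.  Eliminating l by Fourier-Motzkin ([offset_exists]) pairs each X
    with partial X >= 0 with each Y with partial Y < 0, and the resulting
    inequality is exactly sigma(X, Y) <= s ([sigma_le]); the sets X that no edge
    enters or leaves only ask for b X >= 0, which holds since a flow exists.
    Hence the minimum spread is the larger of 0 and the largest sigma(X, Y). *)

(** * Submodular flows in a box *)

(** The least possible contribution of the edge [a] to the net inflow of [X]
    when its flow value ranges over the interval [f a, g a]. *)
Definition edge_inflow (R : realType) (V A : finType) (G : digraph V A)
    (f g : A -> R) (a : A) (X : {set V}) : R :=
  if enters G X a then f a else if leaves G X a then - g a else 0.

Lemma cut_edge_inflow (R : realType) (V A : finType) (G : digraph V A)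
    (f g : A -> R) (X : {set V}) :
  rho_w G f X - delta_w G g X = \sum_a edge_inflow G f g a X.
Proof.
rewrite /rho_w /delta_w big_mkcond [X in _ - X]big_mkcond -sumrB.
apply: eq_bigr => a _; rewrite /edge_inflow /enters /leaves.
by case: (_ \in X); case: (_ \in X); rewrite /= ?subr0 ?sub0r.
Qed.

(** The inequality is strict only when the edge joins [X :\: Y] and [Y :\: X];
    it then enters one of the two sets and leaves the other, contributing
    f a - g a <= 0 on the left and nothing on the right. *)
Lemma edge_inflow_supermodular (R : realType) (V A : finType)
    (G : digraph V A) (f g : A -> R) (a : A) (X Y : {set V}) :
  f a <= g a ->
  edge_inflow G f g a X + edge_inflow G f g a Y
    <= edge_inflow G f g a (X :|: Y) + edge_inflow G f g a (X :&: Y).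
Proof.
rewrite /edge_inflow /enters /leaves !inE => fg.
by case: (src G a \in X); case: (tgt G a \in X); case: (src G a \in Y);
  case: (tgt G a \in Y); rewrite /=; lra.
Qed.

(** If [a] enters [X] and leaves [Y], uncrossing the two sets bounds
    rest X + rest Y, where rest leaves out the contribution of [a], by
    beta X + beta Y; so the upper bound that [X] puts on the value of [a] is
    at least the lower bound that [Y] puts on it. *)
Lemma pin_edge (R : realType) (V A : finType) (G : digraph V A)
    (beta : {set V} -> R) (f g : A -> R) (a : A) :
  (forall X Y, beta (X :|: Y) + beta (X :&: Y) <= beta X + beta Y) ->
  (forall e, f e <= g e) ->
  (forall X, \sum_e edge_inflow G f g e X <= beta X) ->
  exists2 t, f a <= t <= g a &
    forall X, \sum_e edge_inflow G [eta f with a |-> t] [eta g with a |-> t] e X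
              <= beta X.
Proof.
move=> submod fg cutP.
pose rest X := \sum_(e | e != a) edge_inflow G f g e X.
have sumE X : \sum_e edge_inflow G f g e X = edge_inflow G f g a X + rest X.
  by rewrite (bigD1 a).
have rest_super X Y : rest X + rest Y <= rest (X :|: Y) + rest (X :&: Y).
  rewrite /rest -!big_split /=; apply: ler_sum => e _.
  exact: edge_inflow_supermodular.
have Nleave X : enters G X a -> leaves G X a = false.
  by rewrite /enters /leaves => /andP[/negPf -> _].
(* the smallest value allowed by f a and by the sets that a leaves *)
pose t := \big[Num.max/f a]_(Y | leaves G Y a) (rest Y - beta Y).
exists t.
  rewrite /t bigmax_ge_id /=; apply: bigmax_le => // Y aY.
  have := cutP Y; rewrite sumE /edge_inflow aY.
  case: ifP => [/Nleave|_]; first by rewrite aY.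
  lra.
move=> X; rewrite (bigD1 a) //=.
have -> : \sum_(e | e != a)
    edge_inflow G [eta f with a |-> t] [eta g with a |-> t] e X = rest X.
  by apply: eq_bigr => e /negPf ea; rewrite /edge_inflow /= ea.
have := cutP X; rewrite sumE /edge_inflow /= eqxx.
case: ifP => [aX cutX|aX]; last case: ifP => // lX _.
  suff : t <= beta X - rest X by lra.
  apply: bigmax_le => [|Y lY]; first by lra.
  have outside Z : Z = X :|: Y \/ Z = X :&: Y -> rest Z <= beta Z.
    have := cutP Z; rewrite sumE /edge_inflow.
    move: aX lY; rewrite /enters /leaves => /andP[sX tX] /andP[sY tY] + ZE.
    by case: ZE => ->; rewrite !inE (negPf sX) tX sY (negPf tY) /= add0r.
  have := outside _ (or_introl erefl); have := outside _ (or_intror erefl).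
  have := submod X Y; have := rest_super X Y; lra.
suff : rest X - beta X <= t by lra.
exact: le_bigmax_cond.
Qed.

(** Once every edge is pinned, so that f = g, the cut condition says that this
    common vector is a submodular flow. *)
Lemma flow_in_box (R : realType) (V A : finType) (G : digraph V A)
    (beta : {set V} -> R) (f g : A -> R) :
  (forall X Y, beta (X :|: Y) + beta (X :&: Y) <= beta X + beta Y) ->
  (forall e, f e <= g e) ->
  (forall X, rho_w G f X - delta_w G g X <= beta X) ->
  exists2 x : A -> R, (forall e, f e <= x e <= g e) &
    forall X, rho_w G x X - delta_w G x X <= beta X.
Proof.
move=> submod fg cutP.
have [f' [g' [fP f'g' g'P cutP' pinned]]] : exists f' g' : A -> R,
    [/\ forall e, f e <= f' e, forall e, f' e <= g' e, forall e, g' e <= g e,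
        forall X, \sum_e edge_inflow G f' g' e X <= beta X
      & {in enum A, f' =1 g'}].
  elim: (enum A) => [|a s [f' [g' [fP f'g' g'P cutP' pinned]]]].
    by exists f, g; split=> // X; rewrite -cut_edge_inflow.
  have [t /andP[ft tg] cut_t] := pin_edge a submod f'g' cutP'.
  exists [eta f' with a |-> t], [eta g' with a |-> t]; split=> //= e.
  - by case: eqP => [->|_]; rewrite ?(le_trans (fP a)).
  - by case: eqP.
  - by case: eqP => [->|_] //; apply: le_trans tg _.
  - by rewrite inE; case: eqP => //= _ /pinned.
exists f' => [e|X]; first by rewrite fP (le_trans (f'g' e)).
apply: le_trans (cutP' X); rewrite cut_edge_inflow.
by apply: ler_sum => e _; rewrite /edge_inflow (pinned e) ?mem_enum.
Qed.

(** * Constant boxes *)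

Lemma cut_const (R : realType) (V A : finType) (G : digraph V A) (l s : R)
    (X : {set V}) :
  rho_w G (fun=> l) X - delta_w G (fun=> l + s) X
    = l * (partial G X)%:~R - s * (delta G X)%:R.
Proof.
rewrite /rho_w /delta_w !sumr_const /partial rmorphB /= -!pmulrn.
rewrite -[l *+ _]mulr_natr -[(l + s) *+ _]mulr_natr -/(rho G X) -/(delta G X).
ring.
Qed.

Lemma cut_ge_const (R : realType) (V A : finType) (G : digraph V A) (l s : R)
    (x : A -> R) (X : {set V}) :
  (forall a, l <= x a <= l + s) ->
  l * (partial G X)%:~R - s * (delta G X)%:R <= rho_w G x X - delta_w G x X.
Proof.
move=> xP; rewrite -cut_const.
by apply: lerB; apply: ler_sum => a _; case/andP: (xP a).
Qed.

Lemma spread_le (R : realType) (A : finType) (x : A -> R) (l s : R) :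
  0 <= s -> (forall a, l <= x a <= l + s) -> spread x <= s.
Proof.
move=> s0 xP; rewrite /spread; case: pickP => // a0 _.
suff [lP uP] : l <= \big[Num.min/x a0]_a x a /\
               \big[Num.max/x a0]_a x a <= l + s by lra.
split; first by apply: le_bigmin => [|a _]; [have := xP a0 | have := xP a]; lra.
by apply: bigmax_le => [|a _]; [have := xP a0 | have := xP a]; lra.
Qed.

Lemma spread_box (R : realType) (A : finType) (x : A -> R) :
  exists l, forall a, l <= x a <= l + spread x.
Proof.
rewrite /spread; case: pickP => [a0 _|A0]; last by exists 0 => a; have := A0 a.
exists (\big[Num.min/x a0]_a x a) => a.
by rewrite bigmin_le_cond //= addrC subrK le_bigmax_cond.
Qed.

Lemma spread_ge0 (R : realType) (A : finType) (x : A -> R) : 0 <= spread x.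
Proof.
have [l xP] := spread_box x.
case: (pickP [pred a : A | true]) => [a _|A0]; first by have := xP a; lra.
by rewrite /spread; case: pickP => // a; have := A0 a.
Qed.

(** * Eliminating the offset of the box *)

(** For admissible [X] and [Y] the denominator of sigma(X, Y) is positive:
    partial Y < 0 forces delta Y > 0, and delta X > 0 if partial X = 0.
    Clearing it turns sigma(X, Y) <= s into the combination of the constraints
    of [X] and [Y] that eliminates the offset of the box. *)
Lemma sigma_le (R : realType) (V A : finType) (G : digraph V A)
    (b : {set V} -> int) (X Y : {set V}) (s : R) :
  admissible G X Y ->
  (sigma R G b X Y <= s) =
  ((partial G Y)%:~R * ((b X)%:~R + s * (delta G X)%:R)
     <= (partial G X)%:~R * ((b Y)%:~R + s * (delta G Y)%:R)).
Proof.
case=> X0 Y0 XD; rewrite /sigma.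
have den0 : 0 < (delta G Y)%:Z * partial G X - (delta G X)%:Z * partial G Y.
  move: X0 Y0 XD; rewrite /partial; nia.
rewrite ler_pdivrMr ?ltr0z // !(rmorphB, rmorphM) /=.
rewrite -subr_ge0 -[RHS]subr_ge0; congr (0 <= _); ring.
Qed.

Lemma partialC (V A : finType) (G : digraph V A) (X : {set V}) :
  partial G (~: X) = - partial G X.
Proof.
rewrite /partial opprB; congr (_%:Z - _%:Z); apply: eq_card => a;
by rewrite !inE /enters /leaves !inE ?negbK andbC.
Qed.

Lemma admissible_exists (V A : finType) (G : digraph V A) :
  not_eulerian G -> exists X Y, admissible G X Y.
Proof.
case=> v /eqP vN0.
suff adm X : 0 < partial G X -> admissible G X (~: X).
  case/lt_total/orP: vN0 => vP; last by exists [set v], (~: [set v]); apply: adm.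
  exists (~: [set v]), (~: ~: [set v]); apply: adm; rewrite partialC; lra.
move=> XP; split; [exact: ltW | by rewrite partialC oppr_lt0 |].
by move: XP; rewrite /partial; lia.
Qed.

(** Fourier-Motzkin elimination of [l], choosing for [l] the largest of the
    lower bounds given by the sets of negative partial.  When partial X = 0 the
    inequality of [X] does not involve [l]; for [X] crossed by an edge it is
    recovered from sigma(X, Y) <= s for any single [Y]. *)
Lemma offset_exists (R : realType) (V A : finType) (G : digraph V A)
    (b : {set V} -> int) (s : R) :
  not_eulerian G ->
  (forall X, (rho G X + delta G X)%N = 0%N -> 0 <= b X) ->
  (forall X Y, admissible G X Y -> sigma R G b X Y <= s) ->
  exists l, forall X,
    l * (partial G X)%:~R - s * (delta G X)%:R <= (b X)%:~R.
Proof.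
move=> noneul b0 sigma_s.
have [X0 [Y0 [X0P Y0P X0D]]] := admissible_exists noneul.
pose lo Y : R := ((b Y)%:~R + s * (delta G Y)%:R) / (partial G Y)%:~R.
pose l := \big[Num.max/lo Y0]_(Y | partial G Y < 0) lo Y.
exists l => X; rewrite lerBlDr.
case: (ltrgtP (partial G X) 0) => XP.
- by rewrite -ler_ndivrMr ?ltrz0 //; apply: le_bigmax_cond.
- rewrite -ler_pdivlMr ?ltr0z //.
  suff loP Y : partial G Y < 0 ->
      lo Y <= ((b X)%:~R + s * (delta G X)%:R) / (partial G X)%:~R.
    by apply: bigmax_le => [|Y]; apply: loP.
  move=> YP; rewrite ler_pdivlMr ?ltr0z // mulrAC ler_ndivrMr ?ltrz0 //.
  rewrite mulrC [leRHS]mulrC -sigma_le; last first.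
    by split; [exact: ltW | | move: XP; rewrite /partial; lia].
  apply: sigma_s.
  by split; [exact: ltW | | move: XP; rewrite /partial; lia].
- rewrite XP mulr0.
  have [D0|Dpos] := posnP (rho G X + delta G X).
    have -> : delta G X = 0%N by lia.
    by rewrite mulr0 addr0 ler0z b0.
  have adm : admissible G X Y0 by split; rewrite ?XP.
  have := sigma_s _ _ adm; rewrite sigma_le // XP mul0r.
  by rewrite nmulr_rle0 // ltrz0.
Qed.

(** * The minimum spread *)

Lemma sigma_le_spread (R : realType) (V A : finType) (G : digraph V A)
    (b : {set V} -> int) (x : A -> R) (X Y : {set V}) :
  submodular_flow G b x -> admissible G X Y -> sigma R G b X Y <= spread x.
Proof.
move=> xflow adm; rewrite sigma_le //; case: adm => XP YP _.
have [l xl] := spread_box x.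
have cut Z := le_trans (cut_ge_const G Z xl) (xflow Z).
have := cut X; have := cut Y; rewrite !lerBlDr => lY lX.
(* both sides are compared with l * partial X * partial Y *)
apply: (@le_trans _ _ ((partial G Y)%:~R * (l * (partial G X)%:~R))).
  by rewrite ler_wnM2l // lerz0 ltW.
rewrite [leLHS](_ : _ = (partial G X)%:~R * (l * (partial G Y)%:~R)).
  by rewrite ler_wpM2l // ler0z.
ring.
Qed.

Lemma flow_of_spread_le (R : realType) (V A : finType) (G : digraph V A)
    (b : {set V} -> int) (s : R) :
  not_eulerian G -> submodular b ->
  (exists x : A -> R, submodular_flow G b x) -> 0 <= s ->
  (forall X Y, admissible G X Y -> sigma R G b X Y <= s) ->
  exists2 x : A -> R, submodular_flow G b x & spread x <= s.
Proof.
move=> noneul submod [y yflow] s0 sigma_s.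
have b0 X : (rho G X + delta G X)%N = 0%N -> 0 <= b X.
  move=> D0; rewrite -(ler0z R); apply: le_trans (yflow X).
  have [l yl] := spread_box y; apply: le_trans (cut_ge_const G X yl).
  have [r0 d0] : rho G X = 0%N /\ delta G X = 0%N by lia.
  by rewrite /partial r0 d0 !mulr0 subrr.
have [l lP] := offset_exists noneul b0 sigma_s.
have submodR (X Y : {set V}) :
    (b (X :|: Y))%:~R + (b (X :&: Y))%:~R <= (b X)%:~R + (b Y)%:~R :> R.
  by rewrite -!rmorphD /= ler_int.
have [||x xl xflow] := @flow_in_box R V A G _ (fun=> l) (fun=> l + s) submodR.
- by move=> _; rewrite lerDl.
- by move=> X; rewrite cut_const.
by exists x => //; apply: spread_le xl.
Qed.

Theorem theorem3p5 (R : realType) (V A : finType) (G : digraph V A)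
    (b : {set V} -> int)
    (noniso : no_isolated_vertex G)
    (noneul : not_eulerian G)
    (submod : submodular b)
    (feasible : exists x : A -> R, submodular_flow G b x) :
  exists sigma_star M : R,
    [/\ is_minimum (flow_spreads G b) sigma_star,
        is_maximum (sigma_values G b) M
      & sigma_star = if M < 0 then 0 else M].
Proof.
pose adm := [pred P : {set V} * {set V} |
  [&& 0 <= partial G P.1, partial G P.2 < 0 & (0 < rho G P.1 + delta G P.1)%N]].
have admP X Y : reflect (admissible G X Y) (adm (X, Y)) by apply: and3P.
have [X0 [Y0 /admP adm0]] := admissible_exists noneul.
have [[X Y] /admP admXY maxXY] :=
  @arg_maxP _ _ _ _ adm (fun P => sigma R G b P.1 P.2) adm0.
pose M := sigma R G b X Y.
have sigma_M X' Y' : admissible G X' Y' -> sigma R G b X' Y' <= M.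
  by move=> /admP /maxXY.
exists (Num.max 0 M), M; split; last 1 first.
- by case: (ltP M 0).
- have lb x : submodular_flow G b x -> Num.max 0 M <= spread x.
    by move=> xflow; rewrite ge_max spread_ge0 sigma_le_spread.
  have [||x xflow xs] := @flow_of_spread_le R V A G b (Num.max 0 M) noneul
    submod feasible.
  + by rewrite le_max lexx.
  + by move=> X' Y' /sigma_M sM; rewrite le_max sM orbT.
  split; last by move=> _ [y yflow ->]; apply: lb.
  by exists x => //; apply/eqP; rewrite eq_le xs lb.
- by split=> [|_ [X' [Y' [/sigma_M sM ->]]]] //; exists X, Y.
Qed.
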